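(* Let $\mathbb{O} = \{y\in\mathbb{R}^n : A y \preceq_{\mathcal K} b\}$ be an obstacle, where $A\in\mathbb{R}^{l\times n}$, $b\in\mathbb{R}^l$, $\mathcal K\subset\mathbb{R}^l$ is a closed convex pointed cone with non-empty interior, and $\mathbb{O}$ is a convex compact set with non-empty relative interior. Let the controlled object be a point mass at position $p\in\mathbb{R}^n$, i.e. $\mathbb{E}(x)=p$ (identified with the set $\{p\}$). Let $\|\cdot\|$ be a norm on $\mathbb{R}^n$ with dual norm $\|\cdot\|_*$, and let $\mathsf{d}_{\min}\ge 0$. Then $$\mathrm{dist}(\mathbb{E}(x),\mathbb{O}) > \mathsf{d}_{\min} \iff \exists\, \lambda \succeq_{\mathcal K^*} 0 :\ (A p - b)^\top \lambda > \mathsf{d}_{\min},\ \ \|A^\top \lambda\|_* \le 1.$$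
   Context: For a cone $\mathcal K\subset\mathbb{R}^l$ and $a,c\in\mathbb{R}^l$, $a\preceq_{\mathcal K} c$ means $c-a\in\mathcal K$. $\mathcal K^*=\{\lambda\in\mathbb{R}^l : \lambda^\top s\ge 0 \text{ for all } s\in\mathcal K\}$ is the dual cone, and $\lambda\succeq_{\mathcal K^*}0$ means $\lambda\in\mathcal K^*$. The dual norm is $\|z\|_*=\max\{z^\top y : \|y\|\le 1\}$. For sets $\mathbb{E},\mathbb{O}\subset\mathbb{R}^n$, the distance is $\mathrm{dist}(\mathbb{E},\mathbb{O}) := \min_{t\in\mathbb{R}^n}\{\|t\| : (\mathbb{E}+t)\cap\mathbb{O}\neq\emptyset\}$. *)

(* Defs.v *)
From HB Require Import structures.
From mathcomp Require Import all_boot all_order all_algebra.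
From mathcomp Require Import all_classical all_reals all_analysis.

Set Implicit Arguments.
Unset Strict Implicit.
Unset Printing Implicit Defensive.

Import Order.TTheory GRing.Theory Num.Theory.
Import numFieldNormedType.Exports.

Local Open Scope classical_set_scope.
Local Open Scope ring_scope.

Definition dotc (R : realType) (n : nat) (u v : 'cV[R]_n) : R :=
  (u^T *m v) 0 0.

(* Matrices carry a canonical (maximum) norm, so an arbitrary norm on R^n is a
   plain function N satisfying the axioms of Lmodule_isNormed; 0 <= N x and
   N 0 = 0 follow from them. *)
Definition is_norm (R : realType) (n : nat) (N : 'cV[R]_n -> R) : Prop :=
  [/\ forall x y, N (x + y) <= N x + N y,
      forall (a : R) x, N (a *: x) = `|a| * N x
    & forall x, N x = 0 -> x = 0].

(* The unit ball of a norm on R^n is compact and nonempty, so this supremum is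
   a maximum. *)
Definition dual_norm (R : realType) (n : nat) (N : 'cV[R]_n -> R)
    (z : 'cV[R]_n) : R :=
  sup [set dotc z y | y in [set y | N y <= 1]].

Definition is_cone (R : realType) (l : nat) (K : set 'cV[R]_l) : Prop :=
  forall (a : R) s, 0 <= a -> K s -> K (a *: s).

Definition pointed_cone (R : realType) (l : nat) (K : set 'cV[R]_l) : Prop :=
  forall s, K s -> K (- s) -> s = 0.

Definition cone_le (R : realType) (l : nat) (K : set 'cV[R]_l)
    (a c : 'cV[R]_l) : Prop :=
  K (c - a).

Definition dual_cone (R : realType) (l : nat) (K : set 'cV[R]_l) :
    set 'cV[R]_l :=
  [set lambda | forall s, K s -> 0 <= dotc lambda s].

Definition affine_hull (R : realType) (n : nat) (S : set 'cV[R]_n) :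
    set 'cV[R]_n :=
  [set x | exists (k : nat) (w : 'I_k -> R) (v : 'I_k -> 'cV[R]_n),
    [/\ forall i, S (v i), \sum_(i < k) w i = 1
      & x = \sum_(i < k) w i *: v i]].

Definition relative_interior (R : realType) (n : nat) (S : set 'cV[R]_n) :
    set 'cV[R]_n :=
  [set x | S x /\ \forall y \near x, affine_hull S y -> S y].

Definition conic_set (R : realType) (l n : nat) (K : set 'cV[R]_l)
    (A : 'M[R]_(l, n)) (b : 'cV[R]_l) : set 'cV[R]_n :=
  [set y | cone_le K (A *m y) b].

(* The infimum is a minimum when E and O are nonempty and compact. It has the
   junk value 0 when E or O is empty. *)
Definition set_dist (R : realType) (n : nat) (N : 'cV[R]_n -> R)
    (E O : set 'cV[R]_n) : R :=
  inf [set N t | t in [set t | [set e + t | e in E] `&` O !=set0]].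

(* Main.v *)
Require Import Defs.
From HB Require Import structures.
From mathcomp Require Import all_boot all_order all_algebra.
From mathcomp Require Import all_classical all_reals all_analysis.
From mathcomp Require Import ring lra.

Set Implicit Arguments.
Unset Strict Implicit.
Unset Printing Implicit Defensive.

Import Order.TTheory GRing.Theory Num.Theory.
Import numFieldNormedType.Exports.

Local Open Scope classical_set_scope.
Local Open Scope ring_scope.

(** Write [O] for the set of [y] with [b - A y] in [K]. The equivalence is
    Lagrangian duality for the problem of minimizing [N (y - p)] over [O]. Both
    inequalities being strict, it suffices to compare the two sides with some
    radius between [dmin] and the distance.

    Weak duality ([weak_duality]) gives the backward direction: a [lambda] in
    the dual cone is nonnegative on [b - A y] for every [y] in [O], so
    [(A p - b)^T lambda <= (A^T lambda)^T (p - y) <= N (y - p)] as soon as the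
    dual norm of [A^T lambda] is at most 1. Hence [(A p - b)^T lambda] is a
    lower bound of the distance.

    For the forward direction, choose [r] strictly between [dmin] and the
    distance. The closed ball [D] of radius [r] around [p] misses [O], so its
    image under [y |-> b - A y], which is compact and convex, misses the closed
    convex cone [K]. As one set is compact and the other closed, they are
    separated with a positive gap ([strict_separation]). The separating vector
    [mu] lies in the dual cone, and evaluating it on all of [D] gives
    [r * s < (A p - b)^T mu], where [s] is the dual norm of [A^T mu]
    ([separating_multiplier]). Weak duality at any point of [O] shows that [s]
    is positive, and [mu / s] is the required multiplier, with value above
    [r > dmin].

    Two facts of finite dimension support this: an arbitrary norm is equivalent
    to the maximum norm ([seminorm_bounded], [is_norm_coercive]), so that its
    balls are compact and the supremum defining the dual norm is finite; and a
    closed set and a compact set have a nearest pair ([nearest_pair]). *)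

(** * The Euclidean pairing *)

Section Dot.
Variables (R : realType) (n : nat).
Implicit Types (u v w : 'cV[R]_n) (a : R).

Lemma dotcE u v : dotc u v = \sum_i u i 0 * v i 0.
Proof. by rewrite /dotc mxE; apply: eq_bigr => i _; rewrite mxE. Qed.

Lemma dotcC u v : dotc u v = dotc v u.
Proof. by rewrite !dotcE; apply: eq_bigr => i _; rewrite mulrC. Qed.

Lemma dotcDr w u v : dotc w (u + v) = dotc w u + dotc w v.
Proof. by rewrite /dotc mulmxDr mxE. Qed.

Lemma dotcZr a u v : dotc u (a *: v) = a * dotc u v.
Proof. by rewrite /dotc -scalemxAr mxE. Qed.

Lemma dotcNr u v : dotc u (- v) = - dotc u v.
Proof. by rewrite -scaleN1r dotcZr mulN1r. Qed.

Lemma dotcBr w u v : dotc w (u - v) = dotc w u - dotc w v.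
Proof. by rewrite dotcDr dotcNr. Qed.

Lemma dotcDl w u v : dotc (u + v) w = dotc u w + dotc v w.
Proof. by rewrite !(dotcC _ w) dotcDr. Qed.

Lemma dotcZl a u v : dotc (a *: u) v = a * dotc u v.
Proof. by rewrite !(dotcC _ v) dotcZr. Qed.

Lemma dotc0r u : dotc u 0 = 0.
Proof. by rewrite /dotc mulmx0 mxE. Qed.

Lemma dotc_ge0 v : 0 <= dotc v v.
Proof. by rewrite dotcE sumr_ge0// => i _; rewrite -expr2 sqr_ge0. Qed.

Lemma sqr_coord_le_dotc v i : v i 0 ^+ 2 <= dotc v v.
Proof.
rewrite dotcE (bigD1 i)//= -expr2 lerDl.
by rewrite sumr_ge0// => j _; rewrite -expr2 sqr_ge0.
Qed.

Lemma dotc_eq0 v : dotc v v = 0 -> v = 0.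
Proof.
move=> v0; apply/matrixP => i j; rewrite (ord1 j) mxE; apply/eqP.
by rewrite -sqrf_eq0 eq_le sqr_ge0 andbT -v0 sqr_coord_le_dotc.
Qed.

End Dot.

Lemma dotc_mulmx (R : realType) (l n : nat) (A : 'M[R]_(l, n))
    (u : 'cV[R]_n) (v : 'cV[R]_l) :
  dotc (A *m u) v = dotc (A^T *m v) u.
Proof. by rewrite [RHS]dotcC /dotc trmx_mul mulmxA. Qed.

(** * Topology of column vectors *)

Section ColumnTopology.
Variable R : realType.

Lemma normr_coord_le n (u : 'cV[R]_n) i : `|u i 0| <= `|u|.
Proof.
rewrite [leRHS]/Num.Def.normr/= mx_normrE.
exact: (le_bigmax _ (fun ij => `|u ij.1 ij.2|) (i, 0)).
Qed.

Lemma normr_cV_le n (u : 'cV[R]_n) M :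
  0 <= M -> (forall i, `|u i 0| <= M) -> `|u| <= M.
Proof.
move=> M0 uM; rewrite [leLHS]/Num.Def.normr/= mx_normrE.
by apply: bigmax_le => // -[i j] _ /=; rewrite (ord1 j).
Qed.

Lemma seminorm_ge0 n (P : 'cV[R]_n -> R)
    (PD : forall x y, P (x + y) <= P x + P y)
    (PZ : forall a x, P (a *: x) = `|a| * P x) x :
  0 <= P x.
Proof.
have := PD x (-1 *: x); rewrite -{1}[x]scale1r -scalerDl subrr !PZ.
by rewrite normr0 mul0r normrN1 mul1r => ?; lra.
Qed.

(** Expanding a vector on the canonical basis bounds the seminorm by the sum of
    its values there. *)
Lemma seminorm_bounded n (P : 'cV[R]_n -> R)
    (PD : forall x y, P (x + y) <= P x + P y)
    (PZ : forall a x, P (a *: x) = `|a| * P x) :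
  exists2 C, 0 <= C & forall u, P u <= C * `|u|.
Proof.
have P0 : P 0 = 0 by rewrite -(scale0r 0) PZ normr0 mul0r.
exists (\sum_i P (delta_mx i 0)).
  by rewrite sumr_ge0// => i _; exact: seminorm_ge0.
move=> u; rewrite {1}(matrix_sum_delta u).
under eq_bigr do rewrite big_ord1.
rewrite mulr_suml.
elim/big_ind2: _ => [|x a y b xa yb|i _]; first by rewrite P0.
  by rewrite (le_trans (PD _ _))// lerD.
by rewrite PZ mulrC ler_wpM2l ?normr_coord_le ?seminorm_ge0.
Qed.

Lemma linear_cV_continuous n (V : normedModType R)
    (f : {linear 'cV[R]_n -> V}) : continuous f.
Proof.
have [|a x|C C0 fC] := @seminorm_bounded n (fun u => `|f u|).
- by move=> x y; rewrite linearD ler_normD.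
- by rewrite linearZ/= normrZ.
apply: bounded_linear_continuous; apply/linear_boundedP.
exists C; split; first exact: ger0_real.
move=> M CM x; rewrite (le_trans (fC x))// ler_wpM2r//; exact: ltW.
Qed.

Lemma mulmx_continuous l n (A : 'M[R]_(l, n)) :
  continuous (fun u : 'cV[R]_n => A *m u).
Proof. exact: (@linear_cV_continuous n _ (mulmx A)). Qed.

Lemma dotc_continuous n (z : 'cV[R]_n) : continuous (dotc z).
Proof.
move=> u; apply: (@continuous_comp _ _ _ (fun y => z^T *m y) (fun M => M 0 0)).
  exact: mulmx_continuous.
exact: coord_continuous.
Qed.

Lemma dotc_sqr_continuous n : continuous (fun v : 'cV[R]_n => dotc v v).
Proof.
rewrite (_ : (fun _ => _) = (fun v : 'cV[R]_n => \sum_i v i 0 * v i 0)).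
  apply: continuous_big => [|i _ v]; first exact: add_continuous.
  have vi := @coord_continuous R n 1 i 0 v; exact: (cvgM vi vi).
by apply/funext => v; rewrite dotcE.
Qed.

(** Transposition is an isometry for the maximum norms, so this is the
    Heine-Borel property of row vectors. *)
Lemma cV_bounded_closed_compact n (A : set 'cV[R]_n) M :
  (forall u, A u -> `|u| <= M) -> closed A -> compact A.
Proof.
move=> AM Acl.
have trK : trmx @` (trmx @^-1` A) = A :> set 'cV[R]_n.
  apply/seteqP; split=> [_ [u Au <-]//|u Au].
  by exists u^T; rewrite /= ?trmxK.
have norm_tr (u : 'rV[R]_n) : `|u| <= `|u^T|.
  rewrite [leLHS]/Num.Def.normr/= mx_normrE.
  apply: bigmax_le => // -[i j] _ /=; rewrite (ord1 i).
  by have := normr_coord_le u^T j; rewrite mxE.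
have tr_cont : continuous (trmx : 'rV[R]_n -> 'cV[R]_n).
  apply: (@bounded_linear_continuous _ _ _ (@trmx R 1 n)).
  apply/linear_boundedP; exists 1; split => // M' M1 x.
  rewrite (le_trans _ (ler_peMl _ (ltW M1)))//.
  apply: normr_cV_le => // i.
  rewrite mxE [leRHS]/Num.Def.normr/= mx_normrE.
  exact: (le_bigmax _ (fun ij => `|x ij.1 ij.2|) (0, i)).
rewrite -trK; apply: continuous_compact.
  exact: continuous_subspaceT.
apply: bounded_closed_compact.
  exists M; split; first exact: num_real.
  move=> M' MM' u /= /AM uM.
  by rewrite (le_trans (norm_tr u))// (le_trans uM)// ltW.
by move/continuous_closedP : tr_cont; apply.
Qed.

End ColumnTopology.

(** * Strict separation of convex sets *)

Section Separation.
Variable R : realType.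

Lemma convex_setP n (S : set 'cV[R]_n) :
  @convex_set R 'cV[R]_n S <->
  (forall x y (t : R), 0 <= t -> t <= 1 ->
    S x -> S y -> S (t *: x + (1 - t) *: y)).
Proof.
split=> [Sc x y t t0 t1 Sx Sy|Sc x y t].
  by have := Sc x y (Itv01 t0 t1); rewrite !inE; exact.
by rewrite !inE; apply: Sc.
Qed.

(** Among the differences of a point of [K] and a point of [Q] one has least
    Euclidean length: [K] may be cut down to a ball, because the differences
    no longer than a given one are bounded and so is [Q]. *)
Lemma nearest_pair n (K Q : set 'cV[R]_n) :
  closed K -> K !=set0 -> compact Q -> Q !=set0 ->
  exists k q, [/\ K k, Q q & forall k' q', K k' -> Q q' ->
    dotc (k - q) (k - q) <= dotc (k' - q') (k' - q')].
Proof.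
move=> Kcl [k0 Kk0] Qco [q0 Qq0].
have [B QB] : exists B, forall q, Q q -> `|q| <= B.
  have [B [_ QB]] := compact_bounded Qco.
  by exists (B + 1) => q; apply: QB; rewrite ltrDl.
pose m0 := dotc (k0 - q0) (k0 - q0).
have norm_le (k q : 'cV[R]_n) :
    Q q -> dotc (k - q) (k - q) <= m0 -> `|k| <= m0 + 1 + B.
  move=> Qq kq; rewrite -(subrK q k) (le_trans (ler_normD _ _))// lerD ?QB//.
  apply: normr_cV_le => [|i]; first by rewrite addr_ge0// dotc_ge0.
  have := le_trans (sqr_coord_le_dotc _ i) kq.
  rewrite -real_normK ?num_real//.
  by have := normr_ge0 ((k - q) i 0); nra.
pose KB := K `&` [set k | `|k| <= m0 + 1 + B].
have KBco : compact KB.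
  apply: (@cV_bounded_closed_compact _ _ _ (m0 + 1 + B)) => [u []//|].
  apply: closedI => //.
  have /continuous_closedP := @norm_continuous R 'cV[R]_n.
  by move=> /(_ [set x | x <= m0 + 1 + B]); apply; exact: closed_le.
have KB0 : KB k0 by split => //; exact: (norm_le _ q0).
pose f (kq : 'cV[R]_n * 'cV[R]_n) := dotc (kq.1 - kq.2) (kq.1 - kq.2).
have f_cont : continuous f.
  move=> kq; pose g (kq : 'cV[R]_n * 'cV[R]_n) := kq.1 - kq.2.
  apply: (@continuous_comp _ _ _ g (fun v => dotc v v)).
    by apply: cvgB; [exact: cvg_fst|exact: cvg_snd].
  exact: dotc_sqr_continuous.
have [||[k q]] := @compact_EVT_min _ _ f (KB `*` Q) _ (compact_setX KBco Qco).
- by exists (k0, q0).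
- exact: continuous_subspaceT.
rewrite inE => -[[/= Kk _] Qq] kq_min.
exists k, q; split => // k' q' Kk' Qq'.
have [km|/ltW mk] := leP (dotc (k' - q') (k' - q')) m0.
  by apply: (kq_min (k', q')); rewrite inE; do 2?split => //; exact: norm_le km.
by apply: le_trans mk; apply: (kq_min (k0, q0)); rewrite inE.
Qed.

(** The separating direction joins a nearest pair. If some difference [c] had
    [dotc v c < dotc v v], then moving from [v] towards [c] would decrease the
    squared length to first order, contradicting minimality. *)
Lemma strict_separation n (K Q : set 'cV[R]_n) :
  closed K -> @convex_set R 'cV[R]_n K -> K !=set0 ->
  compact Q -> @convex_set R 'cV[R]_n Q -> Q !=set0 ->
  K `&` Q = set0 ->
  exists (v : 'cV[R]_n) (e : R), 0 < e /\
    forall k q, K k -> Q q -> dotc v q + e <= dotc v k.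
Proof.
move=> Kcl /convex_setP Kcvx K0 Qco /convex_setP Qcvx Q0 KQ.
have [k [q [Kk Qq kq_min]]] := nearest_pair Kcl K0 Qco Q0.
set v := k - q in kq_min.
have v_gt0 : 0 < dotc v v.
  rewrite lt_neqAle dotc_ge0 andbT eq_sym; apply/eqP => /dotc_eq0/eqP.
  rewrite subr_eq0 => /eqP kq.
  by have : (K `&` Q) k by [split => //; rewrite kq]; rewrite KQ.
exists v, (dotc v v); split => // k' q' Kk' Qq'.
rewrite -lerBrDl -dotcBr; set c := k' - q'.
rewrite leNgt; apply/negP => vc.
have [vE cE] : v = k - q /\ c = k' - q' by [].
move: v c vE cE vc v_gt0 kq_min => v c vE cE vc v_gt0 kq_min.
have first_order (t : R) : 0 <= t -> t <= 1 ->
    0 <= t * (t * dotc (c - v) (c - v) + 2 * (dotc v c - dotc v v)).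
  move=> t0 t1.
  have := kq_min _ _ (Kcvx _ _ _ t0 t1 Kk' Kk) (Qcvx _ _ _ t0 t1 Qq' Qq).
  have -> : t *: k' + (1 - t) *: k - (t *: q' + (1 - t) *: q)
      = v + t *: (c - v).
    by rewrite vE cE; apply/matrixP => i j; rewrite !mxE; ring.
  rewrite -dotcBr -subr_ge0; move: (c - v) => w.
  rewrite dotcDl !dotcDr !dotcZl !dotcZr (dotcC w v).
  by congr (0 <= _); ring.
pose a := dotc (c - v) (c - v); pose d := dotc v v - dotc v c.
have d0 : 0 < d by rewrite subr_gt0.
have a0 : 0 <= a by exact: dotc_ge0.
(* This step length makes the quadratic term smaller than the linear one. *)
pose t := d / (a + d).
have ad0 : 0 < a + d by rewrite ltr_wpDl.
have t0 : 0 < t by rewrite divr_gt0.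
have t1 : t <= 1 by rewrite ler_pdivrMr// mul1r lerDr.
have := first_order _ (ltW t0) t1; rewrite pmulr_rge0// -/a.
have tad : t * (a + d) = d by rewrite divfK// gt_eqF.
rewrite /d in tad d0 *.
nra.
Qed.

End Separation.

(** * Norms and dual norms *)

Section Norm.
Variables (R : realType) (n : nat) (N : 'cV[R]_n -> R).
Hypothesis N_norm : is_norm N.

Lemma is_norm0 : N 0 = 0.
Proof. by case: N_norm => _ NZ _; rewrite -(scale0r 0) NZ normr0 mul0r. Qed.

Lemma is_normN x : N (- x) = N x.
Proof. by case: N_norm => _ NZ _; rewrite -scaleN1r NZ normrN1 mul1r. Qed.

Lemma is_norm_ge0 x : 0 <= N x.
Proof. by case: N_norm => ND NZ _; exact: seminorm_ge0. Qed.

Lemma is_norm_continuous : continuous N.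
Proof.
case: N_norm => ND NZ _; have [C C0 NC] := seminorm_bounded ND NZ.
have lip x y : `|N x - N y| <= C * `|x - y|.
  rewrite (le_trans _ (NC _))// ler_norml; apply/andP; split.
    by have := ND x (y - x); rewrite subrKC -opprB is_normN; lra.
  by have := ND y (x - y); rewrite subrKC; lra.
have C1 : 0 < C + 1 by rewrite ltr_wpDl.
move=> x; apply/(@cvgrPdist_lt _ _ _ (nbhs x)) => e e0.
apply/(@nbhs_normP R 'cV[R]_n).
exists (e / (C + 1)) => [|y]; rewrite /= ?divr_gt0// => xy.
rewrite (le_lt_trans (lip _ _))//.
rewrite (@le_lt_trans _ _ ((C + 1) * `|x - y|))//.
  by rewrite ler_wpM2r// lerDl.
by rewrite mulrC -ltr_pdivlMr.
Qed.

(** The norm is bounded below on the unit sphere of the maximum norm, which is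
    compact. *)
Lemma is_norm_coercive : exists2 c, 0 < c & forall x, c * `|x| <= N x.
Proof.
case: (N_norm) => _ NZ N_eq0.
pose S := [set x : 'cV[R]_n | `|x| = 1].
have Sco : compact S.
  apply: (@cV_bounded_closed_compact _ _ _ 1) => [u /= -> //|].
  have /continuous_closedP := @norm_continuous R 'cV[R]_n.
  by move=> /(_ [set 1]); apply; exact: closed_eq.
have toS x : x != 0 -> S (`|x|^-1 *: x).
  by move=> x0; rewrite /S /= normrZ normfV normr_id mulVf// normr_eq0.
have [S0|/set0P/negP/negPn/eqP S0] := pselect (S !=set0); last first.
  exists 1 => // x; have [->|/toS] := eqVneq x 0; last by rewrite S0.
  by rewrite is_norm0 normr0 mulr0.
have [s] := compact_EVT_min S0 Sco (continuous_subspaceT is_norm_continuous).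
rewrite inE => Ss s_min; exists (N s).
  rewrite lt_neqAle is_norm_ge0 andbT eq_sym; apply/eqP => /N_eq0 s0.
  by move/eqP : Ss; rewrite s0 normr0 eq_sym oner_eq0.
move=> x; have [->|x0] := eqVneq x 0; first by rewrite is_norm0 normr0 mulr0.
have := s_min _ (mem_set (toS _ x0)); rewrite NZ normfV normr_id.
by rewrite ler_pdivlMl ?normr_gt0// mulrC.
Qed.

Lemma is_norm_ball_compact p r : compact [set y | N (y - p) <= r].
Proof.
have [c c0 Nc] := is_norm_coercive.
apply: (@cV_bounded_closed_compact _ _ _ (r / c + `|p|)) => [u /= Nu|].
  rewrite -(subrK p u) (le_trans (ler_normD _ _))// lerD2r.
  by rewrite ler_pdivlMr// mulrC (le_trans (Nc _)).
have : continuous (fun y : 'cV[R]_n => N (y - p)).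
  move=> y; apply: (@continuous_comp _ _ _ (fun y : 'cV[R]_n => y - p) N).
    exact: (cvgB cvg_id (cvg_cst p)).
  exact: is_norm_continuous.
by move=> /continuous_closedP/(_ [set x | x <= r]); apply; exact: closed_le.
Qed.

Lemma is_norm_ball_convex p r :
  @convex_set R 'cV[R]_n [set y | N (y - p) <= r].
Proof.
case: N_norm => ND NZ _; apply/convex_setP => x y t t0 t1 /= Nx Ny.
have -> : t *: x + (1 - t) *: y - p = t *: (x - p) + (1 - t) *: (y - p).
  by apply/matrixP => i j; rewrite !mxE; ring.
rewrite (le_trans (ND _ _))// !NZ !ger0_norm ?subr_ge0//.
have -> : r = t * r + (1 - t) * r by ring.
by rewrite lerD// ler_wpM2l// subr_ge0.
Qed.

(** Continuity on the compact unit ball; this is what keeps the dual norm from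
    being the default value of an unbounded supremum. *)
Lemma dual_norm_ball_sup z :
  has_sup [set dotc z y | y in [set y | N y <= 1]].
Proof.
have N0 : [set y | N y <= 1] !=set0 by exists 0; rewrite /= is_norm0.
apply: compact_has_sup; first exact: image_nonempty.
apply: continuous_compact.
  by apply: continuous_subspaceT; exact: dotc_continuous.
have := @is_norm_ball_compact 0 1.
by under eq_set do rewrite subr0.
Qed.

Lemma dual_norm_le z c :
  (forall y, N y <= 1 -> dotc z y <= c) -> dual_norm N z <= c.
Proof.
move=> zc; apply: ge_sup => [|_ [y Ny <-]]; last exact: zc.
by case: (dual_norm_ball_sup z).
Qed.

Lemma dual_norm_ge z y : N y <= 1 -> dotc z y <= dual_norm N z.
Proof.
by move=> Ny; apply: sup_upper_bound (dual_norm_ball_sup z) _ _; exists y.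
Qed.

Lemma dual_norm_ge0 z : 0 <= dual_norm N z.
Proof. by rewrite -(dotc0r z) dual_norm_ge// is_norm0. Qed.

Lemma dotc_le_dual_norm z y : dotc z y <= dual_norm N z * N y.
Proof.
case: (N_norm) => _ NZ N_eq0.
have [/N_eq0 ->|Ny] := eqVneq (N y) 0; first by rewrite dotc0r is_norm0 mulr0.
have Ny0 : 0 < N y by rewrite lt_neqAle eq_sym Ny is_norm_ge0.
rewrite mulrC -ler_pdivrMl// -dotcZr dual_norm_ge//.
by rewrite NZ gtr0_norm ?invr_gt0// mulVf.
Qed.

Lemma dual_normZ a z : 0 <= a -> dual_norm N (a *: z) <= a * dual_norm N z.
Proof.
move=> a0; apply: dual_norm_le => y Ny.
by rewrite dotcZl ler_wpM2l// dual_norm_ge.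
Qed.

End Norm.

(** * Distance from a point to a set *)

Section PointDistance.
Variables (R : realType) (n : nat) (N : 'cV[R]_n -> R).
Hypothesis N_norm : is_norm N.

Lemma set_dist_point_le p (O : set 'cV[R]_n) y :
  O y -> set_dist N [set p] O <= N (y - p).
Proof.
move=> Oy; apply: ge_inf.
  by exists 0 => _ [t _ <-]; exact: is_norm_ge0.
exists (y - p) => //; exists y; split => //.
by exists p => //; rewrite subrKC.
Qed.

Lemma set_dist_point_ge p (O : set 'cV[R]_n) c : O !=set0 ->
  (forall y, O y -> c <= N (y - p)) -> c <= set_dist N [set p] O.
Proof.
move=> [y0 Oy0] cN; apply: lb_le_inf.
  exists (N (y0 - p)), (y0 - p) => //; exists y0; split => //.
  by exists p => //; rewrite subrKC.
move=> _ [t [_ [[_ -> <-] Opt]] <-].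
by have := cN _ Opt; rewrite [p + t]addrC addrK.
Qed.

End PointDistance.

(** * Lagrangian duality *)

Section Duality.
Variables (R : realType) (l n : nat) (K : set 'cV[R]_l).
Variables (A : 'M[R]_(l, n)) (b : 'cV[R]_l).
Variable (N : 'cV[R]_n -> R).
Hypothesis N_norm : is_norm N.
Variable p : 'cV[R]_n.

Lemma dual_cone0 (lambda : 'cV[R]_l) :
  cone_le (dual_cone K) 0 lambda = dual_cone K lambda.
Proof. by rewrite /cone_le subr0. Qed.

(** Weak duality: for feasible [y] the pairing of [lambda] with [A y - b] is
    nonpositive, so replacing [b] by [A y] can only increase the left side. *)
Lemma weak_duality (lambda : 'cV[R]_l) y :
  dual_cone K lambda -> conic_set K A b y ->
  dotc (A *m p - b) lambda <= dual_norm N (A^T *m lambda) * N (y - p).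
Proof.
move=> lamK Oy.
have -> : A *m p - b = A *m (p - y) - (b - A *m y).
  by rewrite mulmxBr opprB [in RHS]addrA subrK.
rewrite dotcC dotcBr (dotcC _ (A *m _)) dotc_mulmx.
have := lamK _ Oy; have := dotc_le_dual_norm N_norm (A^T *m lambda) (p - y).
rewrite -(is_normN N_norm (p - y)) opprB; lra.
Qed.

(** A ball around [p] that misses the conic set is sent by [y |-> b - A y] to a
    compact convex set missing [K]. The separating functional is bounded below
    on the cone, hence lies in the dual cone; that it is uniformly positive on
    the ball is, after maximizing over the directions, the inequality below. *)
Lemma separating_multiplier r :
  closed K -> is_cone K -> @convex_set R 'cV[R]_l K -> K 0 -> 0 < r ->
  (forall y, conic_set K A b y -> r < N (y - p)) ->
  exists2 lambda, dual_cone K lambda &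
    r * dual_norm N (A^T *m lambda) < dotc (A *m p - b) lambda.
Proof.
move=> Kcl Kcone Kcvx K0 r0 far.
pose D := [set y | N (y - p) <= r].
pose g (y : 'cV[R]_n) := b - A *m y.
have g_cont : continuous g.
  by move=> y; exact: (cvgB (cvg_cst b) (@mulmx_continuous R l n A y)).
have [|||||v [e [e0 sep]]] := @strict_separation _ _ K (g @` D) Kcl Kcvx _ _.
- by exists 0.
- apply: continuous_compact; first exact: continuous_subspaceT.
  exact: is_norm_ball_compact.
- apply/convex_setP => _ _ t t0 t1 [x Dx <-] [y Dy <-].
  have /convex_setP Dcvx := is_norm_ball_convex N_norm (p:=p) (r:=r).
  exists (t *: x + (1 - t) *: y); first exact: Dcvx.
  rewrite /g mulmxDr -!scalemxAr.
  by apply/matrixP => i j; rewrite !mxE; ring.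
- by exists (g p), p => //; rewrite /D /= subrr is_norm0// ltW.
- rewrite -subset0 => q [Kq [y Dy yq]].
  have Oy : conic_set K A b y by rewrite /conic_set /= /cone_le -/(g y) yq.
  by have := far _ Oy; rewrite ltNge Dy.
have gD y : D y -> dotc v (g y) + e <= 0.
  by move=> Dy; rewrite -(dotc0r v); apply: sep => //; exists y.
have Dp : D p by rewrite /D /= subrr is_norm0// ltW.
exists v.
  move=> k Kk; rewrite leNgt; apply/negP => vk0.
  (* Along a ray where it is negative, the functional comes down to its value
     at the image of the centre, contradicting the gap [e]. *)
  pose a := (dotc v (g p)) / dotc v k.
  have gp0 : dotc v (g p) < 0 by have := gD _ Dp; lra.
  have a0 : 0 <= a by rewrite /a -mulrNN -invrN divr_ge0// oppr_ge0 ltW.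
  have := sep _ _ (Kcone _ _ a0 Kk) (ex_intro2 _ _ _ Dp erefl).
  by rewrite dotcZr divfK ?lt_eqF//; lra.
set z := A^T *m v.
have : dual_norm N z <= (dotc (A *m p - b) v - e) / r.
  apply: dual_norm_le => // u Nu; rewrite ler_pdivlMr//.
  (* Moving from the centre against [u] by [r] is what brings in the radius
     as a factor of the dual norm. *)
  have Dy : D (p - r *: u).
    rewrite /D /= addrAC subrr add0r (is_normN N_norm).
    case: N_norm => _ NZ _; rewrite NZ gtr0_norm// -[leRHS]mulr1.
    by rewrite ler_wpM2l// ltW.
  have := gD _ Dy; rewrite /g mulmxBr -scalemxAr.
  rewrite !dotcBr dotcZr !(dotcC v (A *m _)) (dotc_mulmx A u) -/z.
  rewrite (dotcC (_ - _)) dotcBr (dotcC v (A *m _)); lra.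
by rewrite ler_pdivlMr// => ?; lra.
Qed.

End Duality.

Theorem proposition1 (R : realType) (l n : nat)
    (K : set 'cV[R]_l) (A : 'M[R]_(l, n)) (b : 'cV[R]_l)
    (N : 'cV[R]_n -> R) (p : 'cV[R]_n) (dmin : R)
    (K_closed : closed K)
    (K_cone : is_cone K)
    (K_convex : @convex_set R 'cV[R]_l K)
    (K_pointed : pointed_cone K)
    (K_interior : interior K !=set0)
    (O_convex : @convex_set R 'cV[R]_n (conic_set K A b))
    (O_compact : compact (conic_set K A b))
    (O_relint : relative_interior (conic_set K A b) !=set0)
    (N_norm : is_norm N)
    (dmin_ge0 : 0 <= dmin) :
  set_dist N [set p] (conic_set K A b) > dmin <->
  exists lambda : 'cV[R]_l,
    [/\ cone_le (dual_cone K) 0 lambda,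
        dotc (A *m p - b) lambda > dmin
      & dual_norm N (A^T *m lambda) <= 1].
Proof.
have [y0 [Oy0 _]] := O_relint.
split=> [far|[lambda [lamK lam_gt lam_le1]]]; last first.
  apply: (lt_le_trans lam_gt); apply: set_dist_point_ge => [|y Oy].
    by exists y0.
  move: lamK; rewrite dual_cone0 => lamK.
  rewrite (le_trans (weak_duality N_norm p lamK Oy))//.
  by rewrite ler_piMl// is_norm_ge0.
set dist := set_dist _ _ _ in far.
(* A radius strictly between [dmin] and the distance: it leaves a positive gap
   to the conic set, and the bound it yields is still above [dmin]. *)
pose r := (dmin + dist) / 2.
have r_gt : dmin < r by rewrite /r; lra.
have r_lt : r < dist by rewrite /r; lra.
have r0 : 0 < r by exact: le_lt_trans r_gt.
have K0 : K 0 by rewrite -(scale0r (b - A *m y0)); exact: K_cone.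
have away y : conic_set K A b y -> r < N (y - p).
  by move=> Oy; rewrite (lt_le_trans r_lt)// set_dist_point_le.
have [mu muK] :=
  separating_multiplier N_norm K_closed K_cone K_convex K0 r0 away.
set s := dual_norm _ _ => mu_gt.
have s0 : 0 < s.
  rewrite lt_neqAle eq_sym dual_norm_ge0// andbT; apply/eqP => s0.
  have := weak_duality N_norm p muK Oy0.
  by rewrite -/s s0 mul0r leNgt; move: mu_gt; rewrite s0 mulr0 => ->.
exists (s^-1 *: mu); split.
- rewrite dual_cone0 => k Kk.
  by rewrite dotcZl mulr_ge0 ?invr_ge0 ?(ltW s0)//; exact: muK.
- by rewrite dotcZr ltr_pdivlMl// mulrC (le_lt_trans _ mu_gt)// ler_wpM2r// ltW.
- rewrite -scalemxAr (le_trans (dual_normZ N_norm _ _)) ?invr_ge0 ?(ltW s0)//.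
  by rewrite -/s mulVf// gt_eqF.
Qed.
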